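(* For Lebesgue-almost every $x\in(0,1)$, the sequence $(q_n(x))_{n\in\mathbb N}$ is a Benford sequence. Equivalently, for Lebesgue-almost every $x\in(0,1)$, the sequence $(\log_{10} q_n(x))_{n\in\mathbb N}$ is uniformly distributed mod $1$.
   Context: For irrational $x\in(0,1)$ write its continued fraction expansion $x=[a_1,a_2,\ldots]=1/(a_1+1/(a_2+\cdots))$ with $a_i\in\mathbb N$, and let $p_n/q_n=[a_1,\ldots,a_n]$ (in lowest terms, $q_n\geq 1$) be its $n$-th convergent; $q_n(x)$ denotes this denominator. A sequence $(x_n)$ of real numbers is uniformly distributed (u.d.) mod $1$ if for every $t\in[0,1)$, $\lim_{N\to\infty}\frac1N\#\{1\le n\le N:\{x_n\}\le t\}=t$, where $\{\cdot\}$ denotes the fractional part. For nonzero real $y$, its decimal significand $s(y)$ is the unique $t\in[1,10)$ with $|y|=10^k t$ for some $k\in\mathbb Z$. A sequence $(x_n)$ of nonzero reals is a Benford sequence if $\lim_{N\to\infty}\frac1N\#\{1\le n\le N: s(x_n)\le t\}=\log_{10}(t)$ for all $t\in[1,10)$. *)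

(* Defs.v *)
From HB Require Import structures.
From mathcomp Require Import all_boot all_order all_algebra.
From mathcomp Require Import all_classical all_reals all_analysis.
Set Implicit Arguments. Unset Strict Implicit. Unset Printing Implicit Defensive.
Import Order.TTheory GRing.Theory Num.Theory.
Import numFieldNormedType.Exports.
Local Open Scope classical_set_scope.
Local Open Scope ring_scope.

Section CF.
Variable R : realType.

Definition gauss (x : R) : R := x^-1 - (Num.floor (x^-1))%:~R.

Definition cf_digit (x : R) (n : nat) : nat := Num.truncn ((iter n.-1 gauss x)^-1).

Definition cf_val (s : seq nat) : rat := foldr (fun a r => (a%:R + r)^-1) 0 s.

Definition cf_q (x : R) (n : nat) : int :=
  denq (cf_val [seq cf_digit x k | k <- iota 1 n]).

Definition log10 (y : R) : R := ln y / ln 10.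

(* decimal significand: the t in [1,10) with |y| = 10^k t, k integer *)
Definition significand (y : R) : R :=
  `|y| / (10 `^ (Num.floor (log10 `|y|))%:~R).

Definition benford (u : nat -> R) : Prop :=
  (forall n, (1 <= n)%N -> u n != 0) /\
  forall t : R, 1 <= t < 10 ->
    (fun N : nat => (count (fun n => significand (u n) <= t) (iota 1 N))%:R / N%:R)
      @ \oo --> log10 t.


End CF.

(* Main.v *)
Require Import Defs.
From HB Require Import structures.
From mathcomp Require Import all_boot all_order all_algebra.
From mathcomp Require Import all_classical all_reals all_analysis.
From mathcomp Require Import ring lra zify.
Import Order.TTheory GRing.Theory Num.Theory.
Import numFieldNormedType.Exports.
Local Open Scope classical_set_scope.
Local Open Scope ring_scope.
Set Implicit Arguments. Unset Strict Implicit. Unset Printing Implicit Defensive.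

(* Under Lebesgue measure the pair (y_n, theta_n) = (q_{n-1}/q_n, log10 q_n) is a Markov
   chain: the digit a_{n+1} = a has conditional probability (1+y)/((a+y)(a+1+y)), and it
   moves (y, theta) to (1/(a+y), theta + log10(a+y)).
   Let f be Lipschitz with f(theta + tau) = -f(theta).  Two large digits a and b ~ 10^tau a
   lead to nearby y's with phases differing by about tau, so their contributions cancel;
   hence the iterates of the transfer operator on f tend uniformly to 0.  A Kolmogorov
   maximal inequality on cylinders gives the law of large numbers for the martingale
   differences G(Y_{n+1}) - TG(Y_n), and therefore the averages of f(theta_n) tend to 0
   almost everywhere.
   By the duplication formula the second Bernoulli function beta(z) = {z}^2 - {z} + 1/6 is
   a series of antiperiodic functions gamma(2^l z), so all averages of beta(theta_n + s)
   tend to 0.  Difference quotients of beta bracket the fractional part, and the indicator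
   of {theta} <= s is 1 + s - {theta} - {s - theta}. *)

(** * The law of the next digit *)

Section DigitLaw.
Variable R : realType.
Implicit Types (y B C : R) (g h : nat -> R).

(** The index [i] stands for the digit [i + 1], here and in [digit_mean]. Thus [i.+1%:R + y] is the
    factor by which the new digit multiplies the denominator. *)
Definition digit_law y (i : nat) : R := (1 + y) / ((i.+1%:R + y) * (i.+2%:R + y)).

Definition digit_mean y g : R := limn (series (fun i => digit_law y i * g i)).

Lemma digit_law_ge0 y i : 0 <= y -> 0 <= digit_law y i.
Proof. by move=> y0; apply: divr_ge0; [|apply: mulr_ge0]; apply: addr_ge0. Qed.

(** The bound is free of [y]: [transfer_contract] removes a fixed mass from two digits, the same at
    every state. *)
Lemma digit_law_lb y i : 0 <= y <= 1 -> (i.+2%:R * i.+3%:R)^-1 <= digit_law y i.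
Proof.
move=> /andP[y0 y1]; rewrite /digit_law -(@natr1 R i.+2) -(@natr1 R i.+1).
have a1 : 1 <= i.+1%:R :> R by rewrite ler1n.
set a : R := i.+1%:R in a1 *.
have h1 : 0 < (a + y) * (a + 1 + y) by apply: mulr_gt0; lra.
have h2 : 0 < (a + 1) * (a + 1 + 1) by apply: mulr_gt0; lra.
rewrite ler_pdivlMr // mulrC ler_pdivrMr //; nra.
Qed.

(** The sum telescopes, since [digit_law y i] is [1 + y] times the difference of [1 / (i + 1 + y)]
    and [1 / (i + 2 + y)]. *)
Lemma sum_digit_law y n : 0 <= y ->
  \sum_(0 <= i < n) digit_law y i = 1 - (1 + y) / (n.+1%:R + y).
Proof.
move=> y0; elim: n => [|n IHn]; first by rewrite big_nil divff ?subrr // gt_eqF //; lra.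
rewrite big_nat_recr //= IHn /digit_law -(@natr1 R n.+1).
have a1 : 1 <= n.+1%:R :> R by rewrite ler1n.
field; apply/andP; split; rewrite gt_eqF //; lra.
Qed.

Lemma sum_digit_law_le1 y n : 0 <= y -> \sum_(0 <= i < n) digit_law y i <= 1.
Proof.
by move=> y0; rewrite sum_digit_law // lerBlDr lerDl divr_ge0 ?addr_ge0.
Qed.

Lemma is_cvg_digit_mean y g B : 0 <= y -> (forall i, `|g i| <= B) ->
  cvgn (series (fun i => digit_law y i * g i)).
Proof.
move=> y0 gB; apply: normed_cvg.
change (cvgn (series (fun i => `|digit_law y i * g i|))).
have B0 : 0 <= B by rewrite (le_trans _ (gB 0%N)).
apply: nondecreasing_is_cvgn.
  by apply/nondecreasing_seqP => n; rewrite !seriesEnat /= big_nat_recr //= lerDl.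
exists B => _ [n _ <-]; rewrite seriesEnat /=.
apply: le_trans (_ : \sum_(0 <= i < n) digit_law y i * B <= _).
  apply: ler_sum => i _; rewrite normrM ger0_norm ?digit_law_ge0 //.
  by rewrite ler_wpM2l ?digit_law_ge0.
by rewrite -mulr_suml -[leRHS]mul1r ler_wpM2r // sum_digit_law_le1.
Qed.

(** The bound is asked only from [n0] on: in [transfer_contract] a partial sum shows the
    cancellation only once it contains both digits. *)
Lemma digit_mean_le y g B C n0 : 0 <= y -> (forall i, `|g i| <= B) ->
  (forall n, (n0 <= n)%N -> \sum_(0 <= i < n) digit_law y i * g i <= C) ->
  digit_mean y g <= C.
Proof.
move=> y0 gB gC; apply: limr_le; first exact: is_cvg_digit_mean gB.
by exists n0 => // n /= /gC.
Qed.

Lemma digit_meanZ y g B c : 0 <= y -> (forall i, `|g i| <= B) ->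
  digit_mean y (fun i => c * g i) = c * digit_mean y g.
Proof.
move=> y0 gB; apply: cvg_lim => //.
have -> : series (fun i => digit_law y i * (c * g i)) =
    (fun n => c * series (fun i => digit_law y i * g i) n).
  apply/funext => n; rewrite !seriesEnat /= mulr_sumr.
  by apply: eq_bigr => i _; rewrite mulrCA.
by apply: cvgMr; exact: is_cvg_digit_mean gB.
Qed.

Lemma digit_meanD y g h B C : 0 <= y ->
  (forall i, `|g i| <= B) -> (forall i, `|h i| <= C) ->
  digit_mean y (fun i => g i + h i) = digit_mean y g + digit_mean y h.
Proof.
move=> y0 gB hC; apply: cvg_lim => //.
have -> : series (fun i => digit_law y i * (g i + h i)) =
    (fun n => series (fun i => digit_law y i * g i) n +
      series (fun i => digit_law y i * h i) n).
  apply/funext => n; rewrite !seriesEnat /= -big_split /=.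
  by apply: eq_bigr => i _; rewrite mulrDr.
by apply: cvgD; [exact: is_cvg_digit_mean gB|exact: is_cvg_digit_mean hC].
Qed.

Lemma digit_meanN y g B : 0 <= y -> (forall i, `|g i| <= B) ->
  digit_mean y (fun i => - g i) = - digit_mean y g.
Proof.
move=> y0 gB; rewrite -mulN1r -(digit_meanZ _ y0 gB).
by congr digit_mean; apply/funext => i; rewrite mulN1r.
Qed.

Lemma digit_mean_norm_le y g B C n0 : 0 <= y -> (forall i, `|g i| <= B) ->
  (forall n, (n0 <= n)%N -> `|\sum_(0 <= i < n) digit_law y i * g i| <= C) ->
  `|digit_mean y g| <= C.
Proof.
move=> y0 gB gC; rewrite ler_norml; apply/andP; split.
  rewrite lerNl -(digit_meanN y0 gB); apply: (@digit_mean_le _ _ B _ n0) => // [i|n nn].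
    by rewrite normrN.
  under eq_bigr => i _ do rewrite mulrN.
  by rewrite sumrN (le_trans _ (gC n nn)) // -normrN ler_norm.
apply: (@digit_mean_le _ _ B _ n0) => // n nn.
by rewrite (le_trans (ler_norm _)) ?gC.
Qed.

Lemma digit_mean_bounded y g B : 0 <= y -> (forall i, `|g i| <= B) ->
  `|digit_mean y g| <= B.
Proof.
move=> y0 gB; have B0 : 0 <= B by rewrite (le_trans _ (gB 0%N)).
apply: (@digit_mean_norm_le _ _ B _ 0) => // n _.
apply: le_trans (ler_norm_sum _ _ _) _.
apply: le_trans (_ : \sum_(0 <= i < n) digit_law y i * B <= _).
  apply: ler_sum => i _; rewrite normrM ger0_norm ?digit_law_ge0 //.
  by rewrite ler_wpM2l ?digit_law_ge0.
by rewrite -mulr_suml -[leRHS]mul1r ler_wpM2r // sum_digit_law_le1.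
Qed.

Lemma digit_mean_cst y c : 0 <= y -> digit_mean y (fun=> c) = c.
Proof.
move=> y0; apply: cvg_lim => //.
have -> : series (fun i => digit_law y i * c) =
    (fun n => c - c * ((1 + y) / (n.+1%:R + y))).
  by apply/funext => n; rewrite seriesEnat /= -mulr_suml sum_digit_law //; ring.
rewrite -[X in _ --> X]subr0; apply: cvgB; first exact: cvg_cst.
rewrite -(mulr0 c); apply: cvgMr.
rewrite -(mulr0 (1 + y)); apply: cvgMr.
apply/cvgrPdist_le => e e0; near=> n.
have h : 0 < n.+1%:R + y by rewrite ltr_wpDr.
rewrite sub0r normrN ger0_norm ?invr_ge0 ?(ltW h) //.
rewrite -[leRHS]invrK lef_pV2 ?posrE ?invr_gt0 //.
rewrite (@le_trans _ _ n%:R) //; last by rewrite -natr1; lra.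
near: n; exact: nbhs_infty_ger.
Unshelve. all: end_near. Qed.

Lemma digit_mean_ge_partial y g B n : 0 <= y -> (forall i, 0 <= g i <= B) ->
  \sum_(0 <= i < n) digit_law y i * g i <= digit_mean y g.
Proof.
move=> y0 gB; apply: (nondecreasing_cvgn_le (u_ := series _)).
  apply/nondecreasing_seqP => k; rewrite !seriesEnat /= big_nat_recr //= lerDl //.
  by rewrite mulr_ge0 ?digit_law_ge0 //; case/andP: (gB k).
apply: (@is_cvg_digit_mean _ _ B) => // i; case/andP: (gB i) => g0 gi.
by rewrite ger0_norm.
Qed.

End DigitLaw.

(** * The transfer operator *)

Section Transfer.
Variable R : realType.
Implicit Types (y th tau B C L K M : R) (G : R -> R -> R).

Definition log10e : R := (ln 10)^-1.

Lemma ln10_gt0 : 0 < ln (10 : R).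
Proof. by apply: ln_gt0; rewrite ltr1n. Qed.

Lemma log10e_ge0 : 0 <= log10e.
Proof. by rewrite /log10e invr_ge0 ltW // ln10_gt0. Qed.

(** Follows from [ln (1 + x) <= x] applied to [u / v = 1 + (u - v) / v]. *)
Lemma log10_sub_le (m u v : R) : 0 < m -> m <= u -> m <= v ->
  log10 u - log10 v <= log10e * (`|u - v| / m).
Proof.
move=> m0 mu mv; have v0 : 0 < v by lra. have u0 : 0 < u by lra.
rewrite /log10 -mulrBl mulrC ler_wpM2l ?log10e_ge0 //.
have -> : ln u - ln v = ln (u / v) by rewrite lnM ?lnV ?posrE ?invr_gt0.
have -> : u / v = 1 + (u - v) / v by field; rewrite gt_eqF.
apply: le_trans (le_ln1Dx _) _.
  by rewrite ltr_pdivlMr //; lra.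
apply: (@le_trans _ _ (`|u - v| / v)).
  by rewrite ler_wpM2r ?invr_ge0 ?ler_norm // ltW.
by rewrite ler_wpM2l // lef_pV2.
Qed.

Lemma log10_lipschitz (m u v : R) : 0 < m -> m <= u -> m <= v ->
  `|log10 u - log10 v| <= log10e * (`|u - v| / m).
Proof.
move=> m0 mu mv; rewrite ler_norml log10_sub_le // andbT lerNl opprB.
by rewrite distrC log10_sub_le.
Qed.

Definition transfer G y th : R :=
  digit_mean y (fun i => G (i.+1%:R + y)^-1 (th + log10 (i.+1%:R + y))).

Definition bounded_by B G := forall y th, 0 <= y <= 1 -> `|G y th| <= B.

Definition lip_state L G := forall y y' th, 0 <= y <= 1 -> 0 <= y' <= 1 ->
  `|G y th - G y' th| <= L * `|y - y'|.

Definition lip_phase K G := forall y th th', 0 <= y <= 1 ->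
  `|G y th - G y th'| <= K * `|th - th'|.

Definition antiperiodic tau G := forall y th, 0 <= y <= 1 ->
  G y (th + tau) = - G y th.

Lemma next_state y (i : nat) : 0 <= y -> 0 <= (i.+1%:R + y)^-1 <= 1.
Proof.
move=> y0; have a1 : 1 <= i.+1%:R :> R by rewrite ler1n.
by rewrite invr_ge0 invf_le1; lra.
Qed.

Lemma digit_meanB y (g h : nat -> R) B C : 0 <= y ->
  (forall i, `|g i| <= B) -> (forall i, `|h i| <= C) ->
  digit_mean y g - digit_mean y h = digit_mean y (fun i => g i - h i).
Proof.
move=> y0 gB hC; rewrite -(digit_meanN y0 hC) (digit_meanD y0 gB (C := C)) //.
by move=> i; rewrite normrN.
Qed.

Lemma transfer_bounded B G : bounded_by B G -> bounded_by B (transfer G).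
Proof.
move=> GB y th /andP[y0 y1]; apply: digit_mean_bounded => // i.
by apply/GB/next_state.
Qed.

Lemma transfer_lip_phase B K G : bounded_by B G -> lip_phase K G ->
  lip_phase K (transfer G).
Proof.
move=> GB GK y th th' /andP[y0 y1].
rewrite (@digit_meanB _ _ _ B B) // => [|i|i]; try exact/GB/next_state.
apply: digit_mean_bounded => // i.
apply: le_trans (GK _ _ _ (next_state i y0)) _.
by rewrite opprD addrACA subrr addr0.
Qed.

Lemma transfer_antiperiodic B tau G : bounded_by B G -> antiperiodic tau G ->
  antiperiodic tau (transfer G).
Proof.
move=> GB Gt y th /andP[y0 y1].
rewrite -(@digit_meanN _ _ _ B) // => [|i]; last exact/GB/next_state.
congr digit_mean; apply/funext => i.
by rewrite addrAC Gt // next_state.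
Qed.

(** The ratio of the two laws is a product of three factors, each within [|y - y'|] of 1, the last
    two at most 2; telescoping the product gives [4 + 2 + 1 = 7]. The error is relative to the law
    so that it can be summed over all digits. *)
Lemma digit_law_ratio y y' i : 0 <= y <= 1 -> 0 <= y' <= 1 ->
  `|digit_law y i - digit_law y' i| <= 7 * `|y - y'| * digit_law y i.
Proof.
move=> /andP[y0 y1] /andP[z0 z1]; rewrite /digit_law -(@natr1 R i.+1).
have a1 : 1 <= i.+1%:R :> R by rewrite ler1n.
set a : R := i.+1%:R in a1 *.
(* The second alternative replaces the hypothesis that [t] and [t'] are as far apart as [y] and
   [y']; it is refuted at each use. *)
have step (b t t' : R) : 1 <= b -> 0 <= t <= 1 -> 0 <= t' <= 1 ->
    `|1 - (b + t) / (b + t')| <= `|y - y'| \/ `|t - t'| != `|y - y'|.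
  move=> b1 /andP[t0 t1] /andP[t'0 t'1].
  have [e|] := eqVneq `|t - t'| `|y - y'|; last by right.
  left; have -> : 1 - (b + t) / (b + t') = (t' - t) / (b + t').
    by field; rewrite gt_eqF //; lra.
  rewrite normrM normfV (ger0_norm (x := b + t')); last lra.
  by rewrite distrC e ler_pdivrMr ?ler_peMr //; lra.
have le2 (b t t' : R) : 1 <= b -> 0 <= t <= 1 -> 0 <= t' <= 1 ->
    0 <= (b + t) / (b + t') <= 2.
  move=> b1 /andP[t0 t1] /andP[t'0 t'1].
  by rewrite divr_ge0 ?ler_pdivrMr /=; lra.
have yy : 0 <= y <= 1 by apply/andP.
have zz : 0 <= y' <= 1 by apply/andP.
have b1 : 1 <= a + 1 by lra.
have [r1|] := step 1 y' y (lexx _) zz yy; last by rewrite distrC eqxx.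
have [r2|] := step a y y' a1 yy zz; last by rewrite eqxx.
have [r3|] := step (a + 1) y y' b1 yy zz; last by rewrite eqxx.
have /andP[l2 u2] := le2 a y y' a1 yy zz.
have /andP[l3 u3] := le2 (a + 1) y y' b1 yy zz.
have -> : (1 + y) / ((a + y) * (a + 1 + y)) - (1 + y') / ((a + y') * (a + 1 + y'))
  = (1 - (1 + y') / (1 + y) * ((a + y) / (a + y')) * ((a + 1 + y) / (a + 1 + y')))
    * ((1 + y) / ((a + y) * (a + 1 + y))).
  by field; do ![apply/andP; split]; rewrite gt_eqF //; lra.
rewrite normrM (ger0_norm (x := _ / (_ * _))); last first.
  by rewrite divr_ge0 ?mulr_ge0 //; lra.
apply: ler_wpM2r; first by rewrite divr_ge0 ?mulr_ge0 //; lra.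
move: r1 r2 r3 l2 u2 l3 u3; set x1 := (1 + y') / _; set x2 := _ / (a + y').
set x3 := _ / (a + 1 + y'); move: `|y - y'| (normr_ge0 (y - y')) => d d0.
move: x1 x2 x3 => x1 x2 x3 r1 r2 r3 l2 u2 l3 u3.
have -> : 1 - x1 * x2 * x3 = (1 - x1) * (x2 * x3) + ((1 - x2) * x3 + (1 - x3)) by ring.
have x23p : 0 <= x2 * x3 by exact: mulr_ge0.
have x23 : x2 * x3 <= 4 by nra.
apply: le_trans (ler_normD _ _) _; rewrite normrM.
have h1 : `|1 - x1| * `|x2 * x3| <= d * 4.
  by apply: ler_pM => //; rewrite (ger0_norm x23p).
have h2 : `|(1 - x2) * x3 + (1 - x3)| <= d * 2 + d.
  apply: le_trans (ler_normD _ _) _; rewrite lerD // normrM.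
  by apply: ler_pM => //; rewrite ger0_norm.
lra.
Qed.

(** The weight [(i + 1)^-2] bounds the contraction of the state by the digit [i + 1]. The digit 1
    has probability at most 1/2 and every other weight is at most 1/4, so the mean is at most
    [1/2 + 1/2 * 1/4 = 5/8]. *)
Lemma sum_digit_law_sqr y n : 0 <= y <= 1 ->
  \sum_(0 <= i < n) digit_law y i * (i.+1%:R ^- 2) <= 5 / 8.
Proof.
move=> /andP[y0 y1]; case: n => [|n]; first by rewrite big_nil; lra.
have := sum_digit_law_le1 n.+1 y0; rewrite !big_nat_recl //=.
have p0 : digit_law y 0 <= 1 / 2.
  rewrite /digit_law ler_pdivrMr; last by apply: mulr_gt0; lra.
  nra.
set s := \sum_(_ <= i < _) _; set t := \sum_(_ <= i < _) _ => s1.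
have ts : t <= s / 4.
  rewrite mulr_suml; apply: ler_sum => i _.
  rewrite ler_wpM2l ?digit_law_ge0 // lef_pV2 ?posrE ?exprn_gt0 //.
  have : 2 <= i.+2%:R :> R by rewrite ler_nat.
  by nra.
rewrite expr1n invr1; lra.
Qed.

Lemma digit_mean_diff_le y y' (g g' : nat -> R) B C : 0 <= y -> 0 <= y' ->
  (forall i, `|g i| <= B) -> (forall i, `|g' i| <= B) ->
  (forall n, `|\sum_(0 <= i < n) (digit_law y i * g i - digit_law y' i * g' i)| <= C) ->
  `|digit_mean y g - digit_mean y' g'| <= C.
Proof.
move=> y0 y'0 gB g'B H.
have c : (fun n => series (fun i => digit_law y i * g i) n -
    series (fun i => digit_law y' i * g' i) n) @ \oo --> digit_mean y g - digit_mean y' g'.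
  by apply: cvgB; [exact: is_cvg_digit_mean gB|exact: is_cvg_digit_mean g'B].
have {}c : (fun n => `|series (fun i => digit_law y i * g i) n -
    series (fun i => digit_law y' i * g' i) n|) @ \oo -->
    `|digit_mean y g - digit_mean y' g'| by exact: cvg_norm.
rewrite -(cvg_lim (@Rhausdorff R) c); apply: limr_le.
  by apply/cvg_ex; eexists; exact: c.
apply: nearW => n; apply: le_trans (H n).
by rewrite !seriesEnat /= sumrB.
Qed.

(** An inequality of Doeblin-Fortet type. Changing [y] moves the next state (the term [5 / 8 * L]),
    the next phase ([K * log10e]) and the law of the digit ([7 * B]). The coefficient 5/8 is below
    1, so some Lipschitz constant is preserved under iteration. *)
Lemma transfer_lip_state B L K G : 0 <= B -> 0 <= L -> 0 <= K ->
  bounded_by B G -> lip_phase K G -> lip_state L G ->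
  lip_state (5 / 8 * L + K * log10e + 7 * B) (transfer G).
Proof.
move=> B0 L0 K0 GB GK GL y y' th yy zz; have /andP[y0 y1] := yy; have /andP[z0 z1] := zz.
apply: (@digit_mean_diff_le _ _ _ _ B) => // [i|i|n]; try exact/GB/next_state.
apply: le_trans (ler_norm_sum _ _ _) _; set d := `|y - y'|.
have d0 : 0 <= d by rewrite normr_ge0.
have c0 := log10e_ge0.
apply: (@le_trans _ _ (\sum_(0 <= i < n) (digit_law y i * (i.+1%:R ^- 2) * (L * d) +
   digit_law y i * ((K * log10e + 7 * B) * d)))); last first.
  rewrite big_split /= -!mulr_suml.
  have s1 := sum_digit_law_le1 n y0; have s2 := sum_digit_law_sqr n yy.
  apply: (@le_trans _ _ (5 / 8 * (L * d) + 1 * ((K * log10e + 7 * B) * d))).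
    apply: lerD; apply: ler_wpM2r => //; first exact: mulr_ge0.
    by rewrite mulr_ge0 // addr_ge0 ?mulr_ge0.
  by rewrite le_eqVlt; apply/orP; left; apply/eqP; ring.
apply: ler_sum => i _.
have a1 : 1 <= i.+1%:R :> R by rewrite ler1n.
have ny := next_state i y0; have nz := next_state i z0.
set g := G _ _; set g' := G _ _.
have gg : `|g - g'| <= L * (d * i.+1%:R ^- 2) + K * (log10e * d).
  (* The state is changed first, with the phase of [y] kept; the phase is changed second. *)
  have -> : g - g' = (g - G (i.+1%:R + y')^-1 (th + log10 (i.+1%:R + y))) +
     (G (i.+1%:R + y')^-1 (th + log10 (i.+1%:R + y)) - g') by ring.
  apply: le_trans (ler_normD _ _) _; apply: lerD.
    apply: le_trans (GL _ _ _ ny nz) _; rewrite ler_wpM2l //.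
    have -> : (i.+1%:R + y)^-1 - (i.+1%:R + y')^-1 =
        (y' - y) * ((i.+1%:R + y) * (i.+1%:R + y'))^-1.
      by field; apply/andP; split; rewrite gt_eqF //; lra.
    rewrite normrM distrC -/d ler_wpM2l // ger0_norm; last first.
      by rewrite invr_ge0 mulr_ge0; lra.
    rewrite lef_pV2 ?posrE ?mulr_gt0 ?exprn_gt0 //; nra.
  apply: le_trans (GK _ _ _ nz) _; rewrite ler_wpM2l //.
  have -> : th + log10 (i.+1%:R + y) - (th + log10 (i.+1%:R + y')) =
     log10 (i.+1%:R + y) - log10 (i.+1%:R + y') by ring.
  apply: le_trans (@log10_lipschitz 1 _ _ _ _ _) _; try lra.
  by rewrite divr1 ler_wpM2l //; have -> : i.+1%:R + y - (i.+1%:R + y') = y - y' by ring.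
have -> : digit_law y i * g - digit_law y' i * g' =
  digit_law y i * (g - g') + (digit_law y i - digit_law y' i) * g' by ring.
apply: le_trans (ler_normD _ _) _; rewrite (normrM (digit_law y i)).
rewrite (normrM (_ - _)) (ger0_norm (x := digit_law y i)) ?digit_law_ge0 //.
have g'B : `|g'| <= B by exact: GB.
have := ler_pM (normr_ge0 _) (normr_ge0 _) (digit_law_ratio i yy zz) g'B.
rewrite -/d; move/(lerD (ler_wpM2l (digit_law_ge0 i y0) gg))/le_trans; apply.
by rewrite le_eqVlt; apply/orP; left; apply/eqP; ring.
Qed.

Lemma sum_delta (a n : nat) (g : nat -> R) : (a < n)%N ->
  \sum_(0 <= i < n) (i == a)%:R * g i = g a.
Proof.
move=> an; rewrite big_mkord (bigD1 (Ordinal an)) //= eqxx mul1r big1 ?addr0 //.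
by move=> i /negPf ia; rewrite -val_eqE /= in ia; rewrite ia mul0r.
Qed.

(* The digits [a + 1] and [b + 1 ~ 10^tau (a + 1)] lead to nearby states, but their phases
   differ by about [tau], so antiperiodicity makes their contributions cancel. *)
Lemma transfer_contract (a : nat) tau : 0 < tau <= 1 ->
  exists2 p, 0 < p <= 1 / 2 & forall M L K G, 0 <= L -> 0 <= K ->
  bounded_by M G -> lip_phase K G -> lip_state L G -> antiperiodic tau G ->
  bounded_by ((1 - 2 * p) * M + p * ((L + 10 * K * log10e) / a.+1%:R)) (transfer G).
Proof.
move=> /andP[t0 t1]; set t : R := 10 `^ tau.
have tl : ln t = tau * ln 10 by rewrite ln_powR.
have t_ge1 : 1 <= t by rewrite -(powRr0 10) ler_powR ?ler1n // ltW.
have t_le10 : t <= 10 by rewrite -[leRHS]powRr1 ?ler0n // ler_powR ?ler1n.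
have a1 : 1 <= a.+1%:R :> R by rewrite ler1n.
(* The digit [b + 1] is the first integer above [10^tau (a + 1)]; since [10^tau >= 1], it differs
   from [a + 1]. *)
set b := Num.truncn (t * a.+1%:R).
have ta0 : 0 <= t * a.+1%:R by rewrite mulr_ge0; lra.
have /andP[b1 b2] : b%:R <= t * a.+1%:R < b.+1%:R by exact: truncn_itv.
have ab : (a < b)%N by rewrite truncn_ge_nat // ler_peMl //; lra.
clearbody b.
(* The lower bound of [digit_law_lb] at the index [b]; it decreases in the index, so it also serves
   for [a]. *)
exists (b.+2%:R * b.+3%:R)^-1.
  rewrite invr_gt0 mulr_gt0 //= div1r lef_pV2 ?posrE ?mulr_gt0 //.
  by rewrite -natrM ler_nat mulnC (leq_trans _ (leq_pmulr _ _)).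
set p := _^-1 => M L K G L0 K0 GM GK GL Gt y th yy.
have p0 : 0 < p by rewrite invr_gt0 mulr_gt0.
have /andP[y0 y1] := yy.
set g := fun i : nat => G (i.+1%:R + y)^-1 (th + log10 (i.+1%:R + y)).
have gM i : `|g i| <= M by exact/GM/next_state.
have M0 : 0 <= M by rewrite (le_trans _ (gM 0%N)).
have gab : `|g a + g b| <= (L + 10 * K * log10e) / a.+1%:R.
  have -> : g a + g b =
      (g b - G (a.+1%:R + y)^-1 (th + log10 (b.+1%:R + y))) +
      (G (a.+1%:R + y)^-1 (th + log10 (b.+1%:R + y)) -
       G (a.+1%:R + y)^-1 (th + log10 (a.+1%:R + y) + tau)).
    by rewrite (Gt _ _ (next_state a y0)) /g; ring.
  rewrite [leRHS]mulrDl; apply: le_trans (ler_normD _ _) _; apply: lerD.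
    apply: le_trans (GL _ _ _ (next_state _ y0) (next_state _ y0)) _.
    rewrite ler_wpM2l //.
    have h0 : 0 <= (b.+1%:R + y)^-1 <= a.+1%:R^-1.
      rewrite invr_ge0 lef_pV2 ?posrE; [|lra|lra].
      have : a.+1%:R <= b.+1%:R :> R by rewrite ler_nat ltnS ltnW.
      lra.
    have h1 : 0 <= (a.+1%:R + y)^-1 <= a.+1%:R^-1.
      by rewrite invr_ge0 lef_pV2 ?posrE; lra.
    have /andP[l0 u0] := h0; have /andP[l1 u1] := h1.
    rewrite ler_norml; apply/andP; move: l0 u0 l1 u1.
    move: (b.+1%:R + y)^-1 (a.+1%:R + y)^-1 a.+1%:R^-1 => u v w.
    by move=> *; split; lra.
  apply: le_trans (GK _ _ _ (next_state _ y0)) _.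
  have -> : 10 * K * log10e / a.+1%:R = K * (log10e * (10 / a.+1%:R)) by ring.
  rewrite ler_wpM2l //.
  have -> : th + log10 (b.+1%:R + y) - (th + log10 (a.+1%:R + y) + tau) =
      log10 (b.+1%:R + y) - log10 (t * (a.+1%:R + y)).
    rewrite /log10 lnM ?posrE; [|lra|lra].
    by rewrite tl; field; rewrite gt_eqF // ln10_gt0.
  (* [b + 1] exceeds [t (a + 1)] by at most 1 and [t y] exceeds [y] by at most 9, so the arguments
     of [log10] differ by at most 10. *)
  have b2' : b.+1%:R <= t * a.+1%:R + 1 by rewrite -natr1 lerD2r.
  have tA : a.+1%:R <= t * a.+1%:R by rewrite ler_peMl //; lra.
  have ty1 : y <= t * y by rewrite ler_peMl.
  have ty2 : t * y <= 10 * y by rewrite ler_wpM2r.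
  rewrite mulrDr; apply: le_trans (@log10_lipschitz a.+1%:R _ _ _ _ _) _; [lra..|].
  apply: ler_wpM2l; first exact: log10e_ge0.
  apply: ler_wpM2r; first by rewrite invr_ge0; lra.
  by rewrite ler_norml; apply/andP; split; lra.
apply: (@digit_mean_norm_le _ _ _ M _ b.+1) => // n bn.
have an : (a < n)%N by exact: ltn_trans bn.
(* Mass [p] is taken from each of the two digits. The remaining weights are nonnegative with total
   at most [1 - 2 * p], and the removed part is [p * (g a + g b)], which is small. *)
have -> : \sum_(0 <= i < n) digit_law y i * g i =
  \sum_(0 <= i < n) (digit_law y i - p * (i == a)%:R - p * (i == b)%:R) * g i
   + p * (g a + g b).
  rewrite mulrDr -(sum_delta g an) -(sum_delta g bn) !mulr_sumr -!big_split /=.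
  by apply: eq_bigr => i _; ring.
have ge0 i : 0 <= digit_law y i - p * (i == a)%:R - p * (i == b)%:R.
  have q0 := digit_law_ge0 i y0.
  have [ib|bi] := leqP i b; last first.
    by rewrite !gtn_eqF ?(ltn_trans ab) // !mulr0 !subr0.
  have hp : p <= digit_law y i.
    apply: le_trans (digit_law_lb i yy); rewrite lef_pV2 ?posrE ?mulr_gt0 //.
    by rewrite -!natrM ler_nat leq_mul.
  have [ea|_] := eqVneq i a; have [eb|_] := eqVneq i b; rewrite /= ?mulr1 ?mulr0; [|lra..].
  by move: ab; rewrite -ea eb ltnn.
apply: le_trans (ler_normD _ _) _; apply: lerD; last first.
  by rewrite normrM (gtr0_norm p0) ler_wpM2l // ltW.
apply: le_trans (ler_norm_sum _ _ _) _.
apply: (@le_trans _ _ (\sum_(0 <= i < n)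
    (digit_law y i - p * (i == a)%:R - p * (i == b)%:R) * M)).
  by apply: ler_sum => i _; rewrite normrM (ger0_norm (ge0 i)) ler_wpM2l.
rewrite -mulr_suml ler_wpM2r // !sumrB -[X in _ - X - _]mulr_sumr -[X in _ - _ - X]mulr_sumr.
have d c : (c < n)%N -> \sum_(0 <= i < n) (i == c)%:R = 1 :> R.
  move=> cn; rewrite -[RHS](@sum_delta c n (fun=> 1)) //.
  by apply: eq_bigr => i _; rewrite mulr1.
rewrite (d a) // (d b) //; have s1 := sum_digit_law_le1 n y0; lra.
Qed.

(** All iterates share the constants [B], [K], [L], so one pair of digits and one [p] serve at every
    step: the sup bound shrinks by [1 - 2 * p], up to an error of at most [p * (eps / 2)]. *)
Lemma transfer_decay B K tau (f : R -> R) : 0 < tau <= 1 -> 0 <= K ->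
  (forall th, `|f th| <= B) -> (forall th th', `|f th - f th'| <= K * `|th - th'|) ->
  (forall th, f (th + tau) = - f th) ->
  forall eps, 0 < eps -> exists k, bounded_by eps (iter k transfer (fun=> f)).
Proof.
move=> tt K0 fB fK ft eps e0.
have B0 : 0 <= B by rewrite (le_trans _ (fB 0)).
have c0 := log10e_ge0.
(* The fixed point of [L = 5 / 8 * L + K * log10e + 7 * B]. *)
set L := 8 / 3 * (K * log10e + 7 * B).
have L0 : 0 <= L by rewrite /L !mulr_ge0 // addr_ge0 // mulr_ge0.
have inv k : [/\ bounded_by B (iter k transfer (fun=> f)),
    lip_phase K (iter k transfer (fun=> f)), lip_state L (iter k transfer (fun=> f))
    & antiperiodic tau (iter k transfer (fun=> f))].
  elim: k => [|k [GB GK GL Gt]].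
    split=> [y th _|y th th' _|y y' th _ _|y th _] //=.
    by rewrite subrr normr0 mulr_ge0.
  split; [exact: transfer_bounded|exact: transfer_lip_phase GB GK| |
    exact: transfer_antiperiodic GB Gt].
  have := transfer_lip_state B0 L0 K0 GB GK GL.
  by have -> : 5 / 8 * L + K * log10e + 7 * B = L by rewrite /L; field.
set C := L + 10 * K * log10e.
have C0 : 0 <= C by apply: addr_ge0 => //; rewrite !mulr_ge0.
have [a aC] : exists a : nat, C / a.+1%:R <= eps / 2.
  exists (Num.truncn (C / (eps / 2))); rewrite ler_pdivrMr // mulrC -ler_pdivrMr; last lra.
  apply: ltW; exact: truncnS_gt.
have [p /andP[p0 p1] H] := transfer_contract a tt.
have bd k : bounded_by (eps / 2 + (1 - 2 * p) ^+ k * B) (iter k transfer (fun=> f)).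
  elim: k => [|k IHk] y th yy.
    by apply: le_trans (fB _) _; rewrite expr0; lra.
  have [_ GK GL Gt] := inv k.
  apply: le_trans (H _ _ _ _ L0 K0 IHk GK GL Gt y th yy) _.
  rewrite -/C exprS; have hp : p * (C / a.+1%:R) <= p * (eps / 2).
    by rewrite ler_wpM2l // ltW.
  have pe : 0 <= p * eps by rewrite mulr_ge0 ?ltW.
  move: ((1 - 2 * p) ^+ k) (C / a.+1%:R) hp => r z hp; nra.
have : (fun k => (1 - 2 * p) ^+ k) @ \oo --> (0 : R).
  by apply: cvg_expr; rewrite ger0_norm; lra.
(* Division by [B + 1] covers the case [B = 0]. *)
move=> /cvgrPdist_le /(_ (eps / 2 / (B + 1))) [|k _ /(_ k (leqnn k))].
  by rewrite divr_gt0; lra.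
rewrite /= sub0r normrN ger0_norm ?exprn_ge0; [|lra..] => hk.
exists k => y th yy; apply: le_trans (bd k y th yy) _.
have hB : (1 - 2 * p) ^+ k * B <= eps / 2 / (B + 1) * (B + 1).
  by apply: ler_pM => //; [rewrite exprn_ge0; lra|lra].
rewrite divfK in hB; last by rewrite gt_eqF; lra.
lra.
Qed.

End Transfer.

(** * Continuants and cylinders *)

Section Words.
Implicit Types (w : seq nat) (u v : nat * nat) (a n : nat).

(** A pair stands for numerator and denominator: the step sends [r] to [1 / (a + r)]. Hence the
    image of [(0, 1)] under a word is its convergent, and the image of [(1, 0)], the point at
    infinity, is the preceding convergent. *)
Definition cf_step a u := (u.2, (a * u.2 + u.1)%N).

Definition mobius w u := foldr cf_step u w.

Definition cf_p w := (mobius w (0, 1)%N).1.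
Definition cf_den w := (mobius w (0, 1)%N).2.
Definition cf_p' w := (mobius w (1, 0)%N).1.
Definition cf_den' w := (mobius w (1, 0)%N).2.

(** Linearity of the matrix product. It turns the recursion at the head of the word into the
    classical recurrence for appending a digit. *)
Lemma mobius_lin w i j :
  mobius w (i, j) = (i * cf_p' w + j * cf_p w, i * cf_den' w + j * cf_den w)%N.
Proof.
rewrite /cf_p /cf_p' /cf_den /cf_den'; elim: w => [|a w IHw] /=.
  by rewrite !muln0 !muln1 addn0.
by rewrite {1}/mobius /= -/(mobius w (i, j)) IHw /cf_step /=; congr pair; lia.
Qed.

Lemma cf_den_rcons w a : cf_den (rcons w a) = (a * cf_den w + cf_den' w)%N.
Proof.
rewrite {1}/cf_den /mobius foldr_rcons -/(mobius _ _) /cf_step /= muln1 addn0.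
by rewrite mobius_lin /=; lia.
Qed.

Lemma cf_den'_rcons w a : cf_den' (rcons w a) = cf_den w.
Proof.
rewrite {1}/cf_den' /mobius foldr_rcons -/(mobius _ _) /cf_step /= muln0 add0n.
by rewrite mobius_lin /= mul0n mul1n add0n.
Qed.

Definition digits_pos w := all (leq 1) w.

Lemma cf_den_gt0 w : digits_pos w -> (0 < cf_den w)%N.
Proof.
elim/last_ind: w => [|w a IHw] //; rewrite /digits_pos all_rcons => /andP[a1 wp].
by rewrite cf_den_rcons addn_gt0 muln_gt0 a1 IHw.
Qed.

Lemma cf_den'_le w : digits_pos w -> (cf_den' w <= cf_den w)%N.
Proof.
elim/last_ind: w => [|w a _] //; rewrite /digits_pos all_rcons => /andP[a1 wp].
by rewrite cf_den'_rcons cf_den_rcons (leq_trans _ (leq_addr _ _)) // leq_pmull.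
Qed.

(** Each step has determinant -1. *)
Lemma cf_det w : ((cf_p' w)%:Z * (cf_den w)%:Z - (cf_p w)%:Z * (cf_den' w)%:Z =
  (-1) ^+ size w)%R.
Proof.
elim: w => [|a w IHw]; first by rewrite /cf_p' /cf_p /cf_den /cf_den' /=; lia.
have [e1 e2 e3 e4] : [/\ cf_p' (a :: w) = cf_den' w, cf_p (a :: w) = cf_den w,
  cf_den (a :: w) = (a * cf_den w + cf_p w)%N &
  cf_den' (a :: w) = (a * cf_den' w + cf_p' w)%N] by [].
rewrite e1 e2 e3 e4 /= exprS -IHw !PoszD !PoszM; ring.
Qed.

Lemma cf_coprime w : coprime (cf_p w) (cf_den w).
Proof.
have d := cf_det w; rewrite /coprime -dvdn1.
have : (gcdn (cf_p w) (cf_den w) %| (-1) ^+ size w)%Z.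
  rewrite -d; apply: rpredB; first by rewrite dvdz_mull // dvdzE /= dvdn_gcdr.
  by rewrite dvdz_mulr // dvdzE /= dvdn_gcdl.
by rewrite dvdzE abszX /= exp1n.
Qed.

(* The value at [r] of the Moebius map with matrix columns [(cf_p w, cf_den w)] and
   [(cf_p' w, cf_den' w)]. *)
Lemma foldr_mobius (F : numFieldType) (r : F) w : 0 <= r -> digits_pos w ->
  foldr (fun a z => (a%:R + z)^-1) r w =
  ((cf_p w)%:R + r * (cf_p' w)%:R) / ((cf_den w)%:R + r * (cf_den' w)%:R).
Proof.
move=> r0; elim: w => [|a w IHw] /=.
  by rewrite /cf_p /cf_p' /cf_den /cf_den' /= mulr1 mulr0 addr0 add0r divr1.
move=> /andP[a1 wp]; rewrite IHw //.
have [e1 e2 e3 e4] : [/\ cf_p' (a :: w) = cf_den' w, cf_p (a :: w) = cf_den w,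
  cf_den (a :: w) = (a * cf_den w + cf_p w)%N &
  cf_den' (a :: w) = (a * cf_den' w + cf_p' w)%N] by [].
have d0 : 0 < (cf_den w)%:R + r * (cf_den' w)%:R.
  by rewrite ltr_wpDr ?mulr_ge0 // ltr0n cf_den_gt0.
rewrite e1 e2 e3 e4 -[X in X + _](mulfK (lt0r_neq0 d0)) -mulrDl invf_div.
by congr (_ / _); rewrite !natrD !natrM; ring.
Qed.

Lemma denq_cf_val w : digits_pos w -> denq (cf_val w) = (cf_den w)%:Z.
Proof.
move=> wp; rewrite /cf_val foldr_mobius // !mul0r !addr0.
have := @coprimeq_den (cf_p w) (cf_den w) (cf_coprime w).
by rewrite /= => ->; rewrite eqz_nat gtn_eqF // cf_den_gt0.
Qed.

End Words.

(** * Digits of the Gauss map, cylinders and their lengths *)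

Section Digits.
Variable R : realType.
Implicit Types (x : R) (w : seq nat) (a n : nat).

Definition good x := 0 < x < 1 /\ irrational x.

Definition cf_word x n := [seq cf_digit x k | k <- iota 1 n].

Lemma cf_wordS x n : cf_word x n.+1 = rcons (cf_word x n) (cf_digit x n.+1).
Proof.
have e : iota 1 (n + 1) = rcons (iota 1 n) n.+1 by rewrite iotaD add1n cats1.
by rewrite /cf_word -map_rcons -e addn1.
Qed.

Lemma good_inv x : good x -> exists2 k : nat, (0 < k)%N &
  Num.truncn x^-1 = k /\ x^-1 = k%:R + gauss x.
Proof.
move=> [/andP[x0 x1] _]; exists (Num.truncn x^-1).
  by rewrite truncn_gt0 invf_ge1 // ltW.
have xV0 : 0 <= x^-1 by rewrite invr_ge0 ltW.
split=> //; rewrite /gauss truncn_floor xV0 natr_absz ger0_norm ?floor_ge0 //.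
by rewrite addrC subrK.
Qed.

(** Inversion and integer translation preserve irrationality, so the orbit never reaches 0 and every
    digit is positive. *)
Lemma good_gauss x : good x -> good (gauss x).
Proof.
move=> xg; have [k k0 [tk xk]] := good_inv xg.
have [/andP[x0 x1] xi] := xg.
have gi : irrational (gauss x).
  move=> [q _ qg]; apply: xi; exists ((k%:R + q)^-1) => //.
  by rewrite fmorphV rmorphD /= ratr_nat qg -xk invrK.
split=> //.
have fl : 0 <= gauss x < 1.
  by rewrite /gauss subr_ge0 ltrBlDl floor_le_tmp /= -[1]/(1%:~R) -intrD floorD1_gt.
case/andP: fl => g0 ->; rewrite andbT lt_neqAle g0 andbT.
by apply/eqP => e; apply: gi; exists 0 => //; rewrite -e rmorph0.
Qed.

Lemma good_iter x n : good x -> good (iter n (@gauss R) x).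
Proof. by move=> xg; elim: n => //= n; exact: good_gauss. Qed.

Lemma cf_digit_gt0 x n : good x -> (0 < cf_digit x n)%N.
Proof.
by move=> xg; have [k k0 [tk _]] := good_inv (good_iter n.-1 xg); rewrite /cf_digit tk.
Qed.

Lemma cf_word_pos x n : good x -> digits_pos (cf_word x n).
Proof. by move=> xg; apply/allP => _ /mapP[k _ ->]; exact: cf_digit_gt0. Qed.

Lemma cf_expansion x n : good x ->
  x = foldr (fun a z => (a%:R + z)^-1) (iter n (@gauss R) x) (cf_word x n).
Proof.
move=> xg; elim: n => // n IHn; rewrite {1}IHn cf_wordS foldr_rcons; congr foldr.
have [k _ [tk xk]] := good_inv (good_iter n xg).
by rewrite /cf_digit tk /= -xk invrK.
Qed.

Lemma cf_qE x n : good x -> cf_q x n = (cf_den (cf_word x n))%:Z.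
Proof. by move=> xg; rewrite /cf_q denq_cf_val //; exact: cf_word_pos. Qed.

Definition cf_y w : R := (cf_den' w)%:R / (cf_den w)%:R.
Definition cf_theta w : R := log10 (cf_den w)%:R.
(** The distance between [p / q] and [(p + p') / (q + q')], the images of the tails 0 and 1. *)
Definition cyl_len w : R := ((cf_den w)%:R * ((cf_den w)%:R + (cf_den' w)%:R))^-1.

Lemma cf_y_itv w : digits_pos w -> 0 <= cf_y w <= 1.
Proof.
move=> wp; rewrite /cf_y divr_ge0 //= ler_pdivrMr ?ltr0n ?cf_den_gt0 //.
by rewrite mul1r ler_nat cf_den'_le.
Qed.

Lemma cyl_len_ge0 w : 0 <= cyl_len w.
Proof. by rewrite /cyl_len invr_ge0 mulr_ge0 // addr_ge0. Qed.

Lemma cf_y_rcons w i : digits_pos w ->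
  cf_y (rcons w i.+1) = (i.+1%:R + cf_y w)^-1.
Proof.
move=> wp; have q0 : 0 < (cf_den w)%:R :> R by rewrite ltr0n cf_den_gt0.
have q'0 : 0 <= (cf_den' w)%:R :> R by [].
rewrite /cf_y cf_den'_rcons cf_den_rcons natrD natrM.
have i0 : 0 < i.+1%:R :> R by [].
have h : 0 < i.+1%:R * (cf_den w)%:R + (cf_den' w)%:R :> R.
  by rewrite ltr_wpDr // mulr_gt0.
by field; do ![apply/andP; split]; rewrite gt_eqF //; lra.
Qed.

Lemma cf_theta_rcons w i : digits_pos w ->
  cf_theta (rcons w i.+1) = cf_theta w + log10 (i.+1%:R + cf_y w).
Proof.
move=> wp; have q0 : 0 < (cf_den w)%:R :> R by rewrite ltr0n cf_den_gt0.
have /andP[y0 _] := cf_y_itv wp.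
rewrite /cf_theta cf_den_rcons natrD natrM /log10 -mulrDl -lnM ?posrE //; last first.
  by rewrite ltr_wpDr.
by congr (ln _ / _); rewrite /cf_y; field; rewrite gt_eqF.
Qed.

(** This identifies [digit_law] as the conditional law of the next digit under Lebesgue measure. *)
Lemma cyl_len_rcons w i : digits_pos w ->
  cyl_len (rcons w i.+1) = cyl_len w * digit_law (cf_y w) i.
Proof.
move=> wp; have q0 : 0 < (cf_den w)%:R :> R by rewrite ltr0n cf_den_gt0.
have q'0 : 0 <= (cf_den' w)%:R :> R by [].
rewrite /cyl_len cf_den'_rcons cf_den_rcons natrD natrM /digit_law /cf_y.
have i0 : 0 < i.+1%:R :> R by [].
rewrite -(@natr1 R i.+1); have := mulr_gt0 i0 q0.
by move=> h; field; do ![apply/andP; split]; rewrite gt_eqF //; lra.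
Qed.

Definition cylinder w : set R := [set x | good x /\ cf_word x (size w) = w].

Lemma cylinder_split w : cylinder w `<=` \bigcup_i cylinder (rcons w i.+1).
Proof.
move=> x [xg xw]; exists (cf_digit x (size w).+1).-1 => //; split=> //.
by rewrite size_rcons cf_wordS xw prednK // cf_digit_gt0.
Qed.

Lemma cylinder_itv w : digits_pos w ->
  exists c : R, cylinder w `<=` `[c, c + cyl_len w]%classic.
Proof.
move=> wp; set D : R := (-1) ^+ size w.
have q0 : 0 < (cf_den w)%:R :> R by rewrite ltr0n cf_den_gt0.
have q'0 : 0 <= (cf_den' w)%:R :> R by [].
have dE : (cf_p' w)%:R * (cf_den w)%:R - (cf_p w)%:R * (cf_den' w)%:R = D.
  have /(congr1 (fun z : int => z%:~R : R)) := cf_det w.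
  by rewrite rmorphB !rmorphM /= rmorphXn /= rmorphN1.
exists (if odd (size w) then (cf_p w)%:R / (cf_den w)%:R - cyl_len w
        else (cf_p w)%:R / (cf_den w)%:R) => x [xg xw].
have [/andP[r0 r1] _] := good_iter (size w) xg.
have := cf_expansion (size w) xg; rewrite xw foldr_mobius ?ltW //.
set r := iter _ _ _ in r0 r1 *; move=> xE.
have d0 : 0 < (cf_den w)%:R + r * (cf_den' w)%:R by rewrite ltr_wpDr // mulr_ge0 // ltW.
(* By the determinant identity, [x] lies at distance [r / (q (q + r q'))] from [p / q], on a side
   given by the parity of the length. This distance increases with the tail [r] and at [r = 1]
   equals [cyl_len w]. *)
have xD : x = (cf_p w)%:R / (cf_den w)%:R +
    D * (r / ((cf_den w)%:R * ((cf_den w)%:R + r * (cf_den' w)%:R))).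
  by rewrite xE -dE; field; rewrite !gt_eqF.
have t0 : 0 <= r / ((cf_den w)%:R * ((cf_den w)%:R + r * (cf_den' w)%:R)).
  by rewrite divr_ge0 ?mulr_ge0 // ltW.
have t1 : r / ((cf_den w)%:R * ((cf_den w)%:R + r * (cf_den' w)%:R)) <= cyl_len w.
  have Y0 : 0 < (cf_den w)%:R + (cf_den' w)%:R :> R by rewrite ltr_wpDr.
  have rq : r * (cf_den w)%:R <= (cf_den w)%:R by rewrite ler_piMl // ltW.
  rewrite /cyl_len -[leRHS]div1r ler_pdivrMr ?mulr_gt0 // mulrAC.
  rewrite ler_pdivlMr ?mulr_gt0 // mul1r mulrCA ler_wpM2l ?(ltW q0) //; lra.
rewrite /= in_itv /= xD /D -signr_odd; case: odd => /=; rewrite ?expr1 ?expr0; lra.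
Qed.

End Digits.

(** * A law of large numbers for digit functionals *)

Section LawOfLargeNumbers.
Variable R : realType.
Implicit Types (x c C eta : R) (w : seq nat) (A : set R).

(** A bound on outer measure, which spares measurability proofs for the sets of digit sequences
    below. *)
Definition coverable A c := exists B : set (measurableTypeR R),
  [/\ measurable B, A `<=` B & (lebesgue_measure B <= c%:E)%E].

Lemma coverable_sub A A' c c' : A `<=` A' -> c' <= c -> coverable A' c' -> coverable A c.
Proof.
move=> AA cc [B [mB AB Bc]]; exists B; split=> //; first exact: subset_trans AB.
by apply: le_trans Bc _; rewrite lee_fin.
Qed.

Lemma coverable0 c : 0 <= c -> coverable set0 c.
Proof. by move=> c0; exists set0; split; rewrite ?measure0 ?lee_fin. Qed.

Lemma coverable_bigcup (F : nat -> set R) (c : nat -> R) C :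
  (forall i, coverable (F i) (c i)) -> (forall n, \sum_(0 <= i < n) c i <= C) ->
  coverable (\bigcup_i F i) C.
Proof.
move=> /choice[B HB] cC; exists (\bigcup_i B i); split.
- by apply: bigcup_measurable => i _; have [] := HB i.
- by apply: subset_bigcup => i _; have [] := HB i.
apply: le_trans (_ : (\sum_(i <oo) lebesgue_measure (B i) <= _)%E).
  apply: measure_sigma_subadditive => //; first by move=> i; have [] := HB i.
  by apply: bigcup_measurable => i _; have [] := HB i.
apply: lime_le; first exact: is_cvg_nneseries.
apply: nearW => n; apply: (@le_trans _ _ (\sum_(0 <= i < n) (c i)%:E)%E).
  by apply: lee_sum => i _; have [] := HB i.
by rewrite sumEFin lee_fin.
Qed.

Lemma negligible_coverable A : (forall c, 0 < c -> coverable A c) ->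
  (@lebesgue_measure R).-negligible A.
Proof.
move=> cA; have [B HB] := choice (fun n => cA n.+1%:R^-1 (ltac:(by rewrite invr_gt0))).
have mB : measurable (\bigcap_n B n) by apply: bigcapT_measurable => n; have [] := HB n.
exists (\bigcap_n B n); split=> //; last first.
  by move=> x Ax n _; have [_ + _] := HB n; exact.
apply/eqP; rewrite eq_le measure_ge0 andbT; apply/lee_addgt0Pr => e e0.
rewrite add0e; have /cvgrPdist_lt/(_ _ e0)[n _ /(_ n (leqnn n))] := @cvg_harmonic R.
rewrite /= sub0r normrN ger0_norm ?invr_ge0 // => ne.
have [mBn _ Bn] := HB n.
have BBn : \bigcap_k B k `<=` B n by move=> x; exact.
apply: le_trans (le_measure (@lebesgue_measure R) (mem_set mB) (mem_set mBn) BBn) _.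
by apply: le_trans Bn _; rewrite lee_fin ltW.
Qed.

Lemma ae_impl (P Q : R -> Prop) : (forall x, P x -> Q x) ->
  {ae (@lebesgue_measure R), forall x, P x} -> {ae (@lebesgue_measure R), forall x, Q x}.
Proof. by move=> PQ; apply: negligibleS => x nQ /PQ. Qed.

Lemma coverable_cylinder w : digits_pos w -> coverable (@cylinder R w) (cyl_len R w).
Proof.
move=> wp; have [c H] := @cylinder_itv R w wp; exists `[c, c + cyl_len R w]%classic.
split=> //; rewrite lebesgue_measure_itv /= lte_fin.
case: ifP => // _; last by rewrite lee_fin cyl_len_ge0.
by rewrite -EFinB lee_fin addrAC subrr add0r.
Qed.

(** * Maximal inequality and strong law for martingale differences *)

Section Martingale.
Variables (D : seq nat -> nat -> R) (C : R).
Hypothesis D_bounded : forall w i, digits_pos w -> `|D w i| <= C.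
Hypothesis D_mean0 : forall w, digits_pos w -> digit_mean (cf_y R w) (D w) = 0.

(** The predecessor converts a digit into the index used by [digit_law]. *)
Definition increment x j := D (cf_word x j) (cf_digit x j.+1).-1.

Let C0 : 0 <= C. Proof. exact: le_trans (D_bounded 0 (w := [::]) isT). Qed.

(** The cross term [2 * s * D w i] has mean zero, so one digit adds at most [C ^+ 2] to the second
    moment. *)
Lemma digit_mean_sqr w s t : digits_pos w -> 0 <= t ->
  digit_mean (cf_y R w) (fun i => (s + D w i) ^+ 2 + t) <= s ^+ 2 + C ^+ 2 + t.
Proof.
move=> wp t0; have /andP[y0 _] := @cf_y_itv R w wp.
have Dw i := D_bounded i wp.
have D2 i : 0 <= D w i ^+ 2 <= C ^+ 2.
  by rewrite sqr_ge0 /= -real_normK ?num_real // lerXn2r ?nnegrE.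
have b1 i : `|(2 * s) * D w i| <= `|2 * s| * C by rewrite normrM ler_wpM2l.
have b2 i : `|s ^+ 2 + D w i ^+ 2 + t| <= s ^+ 2 + C ^+ 2 + t.
  have /andP[d1 d2] := D2 i.
  by rewrite ger0_norm ?lerD2r ?lerD2l // !addr_ge0 ?sqr_ge0.
have -> : (fun i => (s + D w i) ^+ 2 + t) =
    (fun i => (2 * s) * D w i + (s ^+ 2 + D w i ^+ 2 + t)).
  by apply/funext => i; ring.
rewrite (digit_meanD y0 b1 b2) (digit_meanZ _ y0 Dw) D_mean0 // mulr0 add0r.
by apply: le_trans (ler_norm _) _; exact: digit_mean_bounded b2.
Qed.

(* Kolmogorov's maximal inequality, by induction on the horizon [k] over subcylinders. *)
Lemma maximal_inequality eta k w s : 0 < eta -> digits_pos w ->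
  coverable [set x | cylinder w x /\ exists2 m, (m <= k)%N &
     eta <= `|s + \sum_(size w <= j < size w + m) increment x j|]
   (cyl_len R w * ((s ^+ 2 + C ^+ 2 * k%:R) / eta ^+ 2)).
Proof.
move=> e0; elim: k w s => [|k IHk] w s wp.
  (* Once [|s|] reaches [eta], the factor beside [cyl_len] is at least 1 and the whole cylinder is
     an admissible cover. *)
  have [es|se] := leP eta `|s|.
    apply: coverable_sub (coverable_cylinder wp) => [x []//|].
    rewrite ler_peMr ?cyl_len_ge0 // ler_pdivlMr ?exprn_gt0 // mul1r mulr0 addr0.
    by rewrite -[leRHS]real_normK ?num_real // lerXn2r ?nnegrE // ltW.
  apply: coverable_sub (coverable0 (lexx 0)).
    move=> x [_ [[|m]// _]]; rewrite addn0 big_geq // addr0 => /le_lt_trans/(_ se).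
    by rewrite ltxx.
  apply: mulr_ge0; first exact: cyl_len_ge0.
  by rewrite mulr0 addr0 divr_ge0 // sqr_ge0.
have [es|se] := leP eta `|s|.
  apply: coverable_sub (coverable_cylinder wp) => [x []//|].
  rewrite ler_peMr ?cyl_len_ge0 // ler_pdivlMr ?exprn_gt0 // mul1r.
  apply: (@le_trans _ _ (s ^+ 2)); last by rewrite lerDl mulr_ge0 ?sqr_ge0.
  by rewrite -[leRHS]real_normK ?num_real // lerXn2r ?nnegrE // ltW.
have rp i : digits_pos (rcons w i.+1) by rewrite /digits_pos all_rcons.
(* Since [|s| < eta], a crossing needs at least one digit; fixing it turns [s] into [s + D w i] and
   leaves the horizon [k]. *)
apply: coverable_sub (_ : _ `<=` _) (lexx _)
  (coverable_bigcup (fun i => IHk (rcons w i.+1) (s + D w i) (rp i)) _).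
  move=> x [xw [[|m] mk]]; first by rewrite addn0 big_geq // addr0 leNgt se.
  have [i _ xwi] := cylinder_split xw.
  move=> H; exists i => //; split=> //; exists m => //; move: H.
  rewrite big_ltn ?addnS ?ltnS ?leq_addr // addrA size_rcons addSn.
  congr (_ <= `|_ + _ + _|); rewrite /increment.
  have [xg xr] := xwi; move: xr; rewrite size_rcons cf_wordS => /rcons_inj[-> ->].
  by [].
move=> n; have /andP[y0 _] := @cf_y_itv R w wp.
under eq_bigr => i _ do rewrite cyl_len_rcons // -mulrA.
rewrite -mulr_sumr ler_wpM2l ?cyl_len_ge0 //.
under eq_bigr => i _ do rewrite mulrA.
rewrite -mulr_suml ler_wpM2r ?invr_ge0 ?sqr_ge0 //.
have t0 : 0 <= C ^+ 2 * k%:R by rewrite mulr_ge0 ?sqr_ge0.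
(* The bounds on the subcylinders add up to a partial sum, with nonnegative terms, of the mean of
   [(s + D w i) ^+ 2 + C ^+ 2 * k]. *)
apply: le_trans (digit_mean_ge_partial (B := (`|s| + C) ^+ 2 + C ^+ 2 * k%:R) _ y0 _) _.
  move=> i; rewrite addr_ge0 ?sqr_ge0 //= lerD2r -real_normK ?num_real //.
  rewrite lerXn2r ?nnegrE ?addr_ge0 //.
  by apply: le_trans (ler_normD _ _) _; rewrite lerD2l D_bounded.
apply: le_trans (digit_mean_sqr s wp t0) _.
by rewrite -addrA lerD2l -(@natr1 R k) mulrDr mulr1 addrC.
Qed.

Lemma sum_half n : \sum_(0 <= i < n) (2 : R) ^- i <= 2.
Proof.
have -> : \sum_(0 <= i < n) (2 : R) ^- i = 2 - 2 * 2 ^- n.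
  elim: n => [|n IHn]; first by rewrite big_nil expr0 invr1; ring.
  by rewrite big_nat_recr //= IHn exprS invfM; field; rewrite expf_neq0.
by rewrite gerBl mulr_ge0 // invr_ge0 exprn_ge0.
Qed.

(** Dyadic blocks: for [2^l <= N < 2^(l+1)] the maximal inequality with threshold [eps * 2^l] and
    horizon [2^(l+1)] costs [2 C^2 / (eps^2 2^l)]. These costs sum over [l >= J] to at most
    [K * 2^-J]. *)
Lemma coverable_large_deviation eps c : 0 < eps -> 0 < c ->
  exists J, coverable [set x | good x /\ exists2 N, (2 ^ J <= N)%N &
     eps * N%:R <= `|\sum_(0 <= j < N) increment x j|] c.
Proof.
move=> e0 c0; set K := 4 * C ^+ 2 / eps ^+ 2.
have CE0 (a : R) : 0 <= a -> 0 <= a * C ^+ 2 / eps ^+ 2.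
  by move=> a0; apply: divr_ge0; [apply: mulr_ge0|]; rewrite ?sqr_ge0.
have K0 : 0 <= K by exact: CE0.
have [J JK] : exists J, K * 2 ^- J <= c.
  have : (fun n => (2^-1 : R) ^+ n) @ \oo --> (0 : R).
    by apply: cvg_expr; rewrite ger0_norm; lra.
  move=> /cvgrPdist_le/(_ (c / (K + 1))) [|J _ /(_ J (leqnn J))].
    by rewrite divr_gt0 //; lra.
  rewrite /= sub0r normrN ger0_norm ?exprn_ge0 ?invr_ge0 // exprVn => h.
  exists J; apply: (@le_trans _ _ (K * (c / (K + 1)))); first by rewrite ler_wpM2l.
  by rewrite mulrA ler_pdivrMr; [nra|lra].
exists J.
pose c_ i := 2 * C ^+ 2 / eps ^+ 2 * (2 ^- J * 2 ^- i).
apply: coverable_sub (_ : _ `<=` _) (lexx _)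
  (@coverable_bigcup (fun i => [set x | cylinder [::] x /\
     exists2 m, (m <= 2 ^ (J + i).+1)%N & eps * 2 ^+ (J + i) <=
     `|0 + \sum_(size ([::] : seq nat) <= j < size ([::] : seq nat) + m) increment x j|])
   c_ _ _ _).
- move=> x [xg [N JN NS]]; have N0 : (0 < N)%N by rewrite (leq_trans _ JN) ?expn_gt0.
  have /andP[l1 l2] := trunc_log_bounds (isT : 1 < 2)%N N0.
  have Jl : (J <= trunc_log 2 N)%N by rewrite trunc_log_max.
  exists (trunc_log 2 N - J)%N => //=; split; first by split.
  exists N; first by rewrite subnKC // ltnW.
  rewrite add0r add0n; apply: le_trans NS; rewrite subnKC //.
  by rewrite ler_wpM2l ?(ltW e0) // -natrX ler_nat.
- move=> i; have p0 : 0 < eps * 2 ^+ (J + i) by rewrite mulr_gt0 ?exprn_gt0.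
  apply: coverable_sub (maximal_inequality (2 ^ (J + i).+1) 0 p0 (isT : digits_pos [::])) => //.
  rewrite /cyl_len /cf_den /cf_den' /= addr0 mulr1 invr1 mul1r expr0n add0r.
  rewrite /c_ -invfM -exprD natrX (exprS 2 (J + i)).
  have : 2 ^+ (J + i) != 0 :> R by rewrite expf_neq0.
  move: (2 ^+ (J + i)) => X X0; rewrite le_eqVlt; apply/orP; left; apply/eqP.
  by field; rewrite X0 gt_eqF.
move=> n; rewrite /c_ -mulr_sumr -mulr_sumr; apply: le_trans JK.
have -> : K * 2 ^- J = 2 * C ^+ 2 / eps ^+ 2 * (2 ^- J * 2) by rewrite /K; ring.
apply: ler_wpM2l; first exact: CE0.
by rewrite ler_wpM2l ?invr_ge0 ?exprn_ge0 // sum_half.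
Qed.

(** If convergence fails at [x], some level [1 / (n + 1)] is exceeded for arbitrarily large [N]; for
    each [n] the set of such points has covers of arbitrarily small measure. *)
Lemma martingale_lln : {ae (@lebesgue_measure R), forall x, good x ->
  (fun N => (\sum_(0 <= j < N) increment x j) / N%:R) @ \oo --> (0 : R)}.
Proof.
pose bad n := [set x | good x /\ forall J, exists2 N, (2 ^ J <= N)%N &
  n.+1%:R^-1 * N%:R <= `|\sum_(0 <= j < N) increment x j|].
have : (@lebesgue_measure R).-negligible (\bigcup_n bad n).
  apply: negligible_bigcup => n; apply: negligible_coverable => c c0.
  have e0 : 0 < n.+1%:R^-1 :> R by rewrite invr_gt0.
  have [J HJ] := coverable_large_deviation e0 c0.
  by apply: coverable_sub HJ => // x [xg /(_ J)].
apply: negligibleS => x /not_implyP[xg xN]; apply: contrapT => xb; apply: xN.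
apply/cvgrPdist_le => e e0.
have /cvgrPdist_lt/(_ _ e0)[n _ /(_ n (leqnn n))] := @cvg_harmonic R.
rewrite /= sub0r normrN ger0_norm ?invr_ge0 // => ne.
have [J HJ] : exists J, forall N, (2 ^ J <= N)%N ->
    `|\sum_(0 <= j < N) increment x j| < n.+1%:R^-1 * N%:R.
  apply: contrapT => H; apply: xb; exists n => //; split=> // J.
  apply: contrapT => H2; apply: H; exists J => N JN; rewrite ltNge; apply/negP => H3.
  by apply: H2; exists N.
exists (2 ^ J)%N => // N /= JN; have N0 : (0 < N)%N by rewrite (leq_trans _ JN) ?expn_gt0.
rewrite sub0r normrN normrM normfV (ger0_norm (x := N%:R)) // ler_pdivrMr ?ltr0n //.
by apply: le_trans (ltW (HJ N JN)) _; rewrite ler_wpM2r // ltW.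
Qed.

End Martingale.
End LawOfLargeNumbers.

(** * Equidistribution of antiperiodic averages *)

Section Averages.
Variable R : realType.
Implicit Types (z : nat -> R) (B : R).

Definition average z (N : nat) : R := (\sum_(0 <= j < N) z j) / N%:R.

Lemma averageD z z' N : average (fun j => z j + z' j) N = average z N + average z' N.
Proof. by rewrite /average big_split mulrDl. Qed.

Lemma averageB z z' N : average (fun j => z j - z' j) N = average z N - average z' N.
Proof. by rewrite /average sumrB mulrBl. Qed.

Lemma averageZ c z N : average (fun j => c * z j) N = c * average z N.
Proof. by rewrite /average -mulr_sumr mulrA. Qed.

Lemma average_cst c N : (0 < N)%N -> average (fun=> c) N = c.
Proof.
move=> N0; rewrite /average sumr_const_nat subn0 -(mulr_natr c).
by rewrite mulfK // pnatr_eq0 -lt0n.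
Qed.

Lemma le_average z z' N : (forall j, z j <= z' j) -> average z N <= average z' N.
Proof. by move=> zz; rewrite /average ler_wpM2r ?invr_ge0 //; apply: ler_sum. Qed.

Lemma average_bounded z B N : 0 <= B -> (forall j, `|z j| <= B) -> `|average z N| <= B.
Proof.
move=> B0 zB; case: N => [|N]; first by rewrite /average invr0 mulr0 normr0.
have cB c : average (fun=> c) N.+1 = c by rewrite average_cst.
rewrite ler_norml -{1}(cB (- B)) -{2}(cB B); apply/andP.
by split; apply: le_average => j; have := zB j; rewrite ler_norml => /andP[].
Qed.

Lemma eq_cvg_seq (u v : nat -> R) (l : R) : (forall N, u N = v N) ->
  v @ \oo --> l -> u @ \oo --> l.
Proof. by move=> /funext->. Qed.

Lemma cvg_average_cst c : average (fun=> c) @ \oo --> c.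
Proof.
apply: (@cvg_trans _ ((fun=> c) @ \oo)); last exact: cvg_cst.
by apply: near_eq_cvg; exists 1%N => // N /= N0; rewrite average_cst.
Qed.

(** The difference telescopes to [(z N - z 0) / N]. *)
Lemma cvg_average_shift z B : (forall j, `|z j| <= B) ->
  (fun N => average (fun j => z j.+1) N - average z N) @ \oo --> (0 : R).
Proof.
move=> zB; have B0 : 0 <= B by rewrite (le_trans _ (zB 0%N)).
apply/cvgrPdist_le => e e0; near=> N.
have N0 : 0 < N%:R :> R by rewrite ltr0n; near: N; exists 1%N.
rewrite sub0r normrN -averageB /average telescope_sumr // normrM normfV.
rewrite (gtr0_norm N0) ler_pdivrMr //.
apply: (@le_trans _ _ (B + B)).
  by apply: le_trans (ler_normB _ _) _; exact: lerD.
rewrite -ler_pdivrMl //; near: N; exact: nbhs_infty_ger.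
Unshelve. all: end_near. Qed.

Lemma cvg0_approx (u : nat -> R) :
  (forall eps, 0 < eps -> exists2 v : nat -> R,
     (fun N => u N - v N) @ \oo --> (0 : R) & forall N, `|v N| <= eps) ->
  u @ \oo --> (0 : R).
Proof.
move=> H; apply/cvgrPdist_le => e e0; have e2 : 0 < e / 2 by lra.
have [v /cvgrPdist_le/(_ _ e2) uv vb] := H _ e2.
near=> N; have : `|0 - (u N - v N)| <= e / 2 by near: N.
have vN := vb N; rewrite !sub0r !normrN => uvN.
rewrite -(subrK (v N) (u N)); apply: le_trans (ler_normD _ _) _; lra.
Unshelve. all: end_near. Qed.

(** The strong law compares [G] at time [j + 1] with its conditional mean at time [j]; the time
    shift vanishes in the average. *)
Lemma average_transfer (G : R -> R -> R) B : bounded_by B G ->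
  {ae (@lebesgue_measure R), forall x, good x ->
  (fun N => average (fun j => G (cf_y R (cf_word x j)) (cf_theta R (cf_word x j))) N -
     average (fun j => transfer G (cf_y R (cf_word x j)) (cf_theta R (cf_word x j))) N)
  @ \oo --> (0 : R)}.
Proof.
move=> GB.
pose D w i := G (cf_y R (rcons w i.+1)) (cf_theta R (rcons w i.+1)) -
  transfer G (cf_y R w) (cf_theta R w).
have rp w i : digits_pos w -> digits_pos (rcons w i.+1).
  by move=> wp; rewrite /digits_pos all_rcons.
have D_bounded w i : digits_pos w -> `|D w i| <= B + B.
  move=> wp; apply: le_trans (ler_normB _ _) _; apply: lerD.
    by apply: GB; apply/cf_y_itv/rp.
  exact/transfer_bounded/cf_y_itv.
have D_mean0 w : digits_pos w -> digit_mean (cf_y R w) (D w) = 0.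
  move=> wp; have /andP[y0 _] := @cf_y_itv R w wp.
  rewrite -(@digit_meanB _ _ _ _ B `|transfer G (cf_y R w) (cf_theta R w)|) //; last first.
    by move=> i; apply/GB/cf_y_itv/rp.
  rewrite digit_mean_cst // /transfer; apply/eqP; rewrite subr_eq0; apply/eqP.
  congr digit_mean; apply/funext => i.
  by rewrite cf_y_rcons // cf_theta_rcons.
apply: ae_impl (martingale_lln D_bounded D_mean0) => x H xg.
pose Y j := G (cf_y R (cf_word x j)) (cf_theta R (cf_word x j)).
have YB j : `|Y j| <= B by apply: GB; apply: cf_y_itv; exact: (cf_word_pos j xg).
have E N : average Y N -
    average (fun j => transfer G (cf_y R (cf_word x j)) (cf_theta R (cf_word x j))) N =
    average (increment D x) N - (average (fun j => Y j.+1) N - average Y N).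
  have -> : average (increment D x) N = average (fun j => Y j.+1) N -
     average (fun j => transfer G (cf_y R (cf_word x j)) (cf_theta R (cf_word x j))) N.
    rewrite -averageB; congr average; apply/funext => j.
    by rewrite /increment /D prednK ?cf_digit_gt0 // -cf_wordS.
  by ring.
apply: eq_cvg_seq E _.
rewrite -[X in _ --> X](subr0 0); apply: cvgB; first exact: (H xg).
exact: cvg_average_shift YB.
Qed.

Lemma antiperiodic_average (f : R -> R) tau K B : 0 < tau <= 1 -> 0 <= K ->
  (forall th, `|f th| <= B) -> (forall th th', `|f th - f th'| <= K * `|th - th'|) ->
  (forall th, f (th + tau) = - f th) ->
  {ae (@lebesgue_measure R), forall x, good x ->
     average (fun j => f (cf_theta R (cf_word x j))) @ \oo --> (0 : R)}.
Proof.
move=> tt K0 fB fK ft; pose F k := iter k (@transfer R) (fun=> f).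
have FB k : bounded_by B (F k).
  by elim: k => [|k IHk]; [move=> y th _; exact: fB|exact: transfer_bounded].
(* A single null set serves all iterates [k], so [k] may be chosen after [x]. *)
apply: ae_impl (ae_foralln (fun k => average_transfer (FB k))) => x H xg.
pose A k := average (fun j => F k (cf_y R (cf_word x j)) (cf_theta R (cf_word x j))).
have A0 k : (fun N => A 0%N N - A k N) @ \oo --> (0 : R).
  elim: k => [|k IHk].
    by apply: (eq_cvg_seq (v := fun=> 0)) => [N|]; [rewrite subrr|exact: cvg_cst].
  have E N : A 0%N N - A k.+1 N = (A 0%N N - A k N) + (A k N - A k.+1 N).
    by rewrite addrA subrK.
  apply: eq_cvg_seq E _.
  by rewrite -[X in _ --> X](addr0 0); apply: cvgD => //; exact: H.
apply: cvg0_approx => e e0.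
have [k kb] := transfer_decay tt K0 fB fK ft e0.
exists (A k); first exact: (A0 k).
by move=> N; apply: average_bounded (ltW e0) _ => j; apply/kb/cf_y_itv; exact: (cf_word_pos j xg).
Qed.

End Averages.

(** * From the second Bernoulli function to intervals *)

Section BernoulliFunction.
Variable R : realType.
Implicit Types (s t z : R).

Definition frac z : R := z - (Num.floor z)%:~R.

Definition bern t : R := t ^+ 2 - t + 1 / 6.

Definition beta z : R := bern (frac z).

Lemma frac_itv z : 0 <= frac z < 1.
Proof.
rewrite /frac subr_ge0 ltrBlDl floor_le_tmp /=.
by rewrite -[X in _ + X]/(1%:~R) -intrD floorD1_gt.
Qed.

Lemma fracE z (n : int) : n%:~R <= z < n%:~R + 1 -> frac z = z - n%:~R.
Proof. by move=> H; rewrite /frac (@floor_def _ _ n) // intrD. Qed.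

(** The right endpoint is allowed because [bern] agrees at 0 and 1; this removes boundary cases
    later. *)
Lemma betaE z (n : int) : n%:~R <= z <= n%:~R + 1 -> beta z = bern (z - n%:~R).
Proof.
move=> /andP[h1]; rewrite le_eqVlt => /orP[/eqP->|h2]; last first.
  by rewrite /beta (@fracE _ n) // h1.
rewrite /beta (@fracE _ (n + 1)) intrD; last by rewrite lexx ltrDl ltr01.
by rewrite /bern; field.
Qed.

Lemma floor_bounds z : (Num.floor z)%:~R <= z <= (Num.floor z)%:~R + 1.
Proof. by have := frac_itv z; rewrite /frac => /andP[? ?]; apply/andP; split; lra. Qed.

Lemma betaD1 z : beta (z + 1) = beta z.
Proof.
have H := floor_bounds z.
rewrite (@betaE _ (Num.floor z + 1)) intrD; last by rewrite !lerD2r.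
by rewrite (betaE H); congr bern; ring.
Qed.

Lemma betaN z : beta (- z) = beta z.
Proof.
have H := floor_bounds z; have /andP[h1 h2] := H.
rewrite (@betaE _ (- Num.floor z - 1)) !(intrD, rmorphN) /=; last by apply/andP; split; lra.
by rewrite (betaE H) /bern; field.
Qed.

Lemma beta_bounded z : `|beta z| <= 1 / 6.
Proof.
have /andP[h1 h2] := frac_itv z; rewrite /beta /bern ler_norml.
by move: (frac z) h1 h2 => t t0 t1; apply/andP; split; nra.
Qed.

(** On a unit interval the slope [2 t - 1] is at most 1 in absolute value. An increment below 1
    crosses at most one integer and is split there; for longer ones the sup bound suffices. *)
Lemma beta_lipschitz z z' : `|beta z - beta z'| <= `|z - z'|.
Proof.
wlog zz : z z' / z <= z'.
  by move=> H; have [/H//|/ltW/H] := leP z z'; rewrite distrC (distrC z').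
have /andP[h1 h2] := floor_bounds z.
rewrite (ler0_norm (x := z - z')); last lra.
have near_ (n : int) t t' : n%:~R <= t -> t <= t' -> t' <= n%:~R + 1 ->
    `|beta t - beta t'| <= t' - t.
  move=> nt tt' t'n; rewrite (@betaE _ n) ?(@betaE t' n); [|apply/andP; split; lra..].
  rewrite /bern; have : 0 <= t - n%:~R by lra. have : t' - n%:~R <= 1 by lra.
  rewrite ler_norml; move: (n%:~R) => m a b; apply/andP; split; nra.
have [z'n|nz'] := leP z' ((Num.floor z)%:~R + 1); first by rewrite opprB; exact: near_ z'n.
have [far|close] := leP 1 (z' - z).
  apply: le_trans (ler_normB _ _) _.
  have := beta_bounded z; have := beta_bounded z' => b1 b2; lra.
have e1 : ((Num.floor z + 1)%:~R : R) = (Num.floor z)%:~R + 1 by rewrite intrD.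
have := near_ (Num.floor z) z ((Num.floor z)%:~R + 1) h1 h2 (lexx _).
have := near_ (Num.floor z + 1) ((Num.floor z)%:~R + 1) z'; rewrite e1 => H2 H1.
have {}H2 : `|beta ((Num.floor z)%:~R + 1) - beta z'| <= z' - ((Num.floor z)%:~R + 1).
  by apply: H2; lra.
rewrite -(subrKA (beta ((Num.floor z)%:~R + 1))); apply: le_trans (ler_normD _ _) _; lra.
Qed.

Lemma beta_duplication z : beta z + beta (z + 1 / 2) = beta (2 * z) / 2.
Proof.
have H := floor_bounds z; have /andP[h1 h2] := H; set n := Num.floor z in H h1 h2.
rewrite (betaE H); have [t|t] := leP (z - n%:~R) (1 / 2).
  rewrite (@betaE _ n); last by apply/andP; split; lra.
  rewrite (@betaE (2 * z) (n + n)) intrD; last by apply/andP; split; lra.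
  by rewrite /bern; field.
rewrite (@betaE _ (n + 1)) intrD; last by apply/andP; split; lra.
rewrite (@betaE (2 * z) (n + n + 1)) !intrD; last by apply/andP; split; lra.
by rewrite /bern; field.
Qed.

(** An equality when no integer is crossed; a crossing lowers the left side by
    [2 * (frac z + d - 1)]. *)
Lemma beta_forward d z : 0 < d <= 1 ->
  beta (z + d) - beta z <= 2 * d * frac z - d + d ^+ 2.
Proof.
move=> /andP[d0 d1]; have H := floor_bounds z; have /andP[h1 h2] := H.
rewrite (betaE H) /frac; have [t|t] := leP (z + d) ((Num.floor z)%:~R + 1).
  rewrite (@betaE (z + d) (Num.floor z)); last by apply/andP; split; lra.
  by rewrite /bern; nra.
rewrite (@betaE (z + d) (Num.floor z + 1)) intrD; last by apply/andP; split; lra.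
by rewrite /bern; nra.
Qed.

Lemma beta_backward d z : 0 < d <= 1 ->
  2 * d * frac z - d - d ^+ 2 <= beta z - beta (z - d).
Proof.
move=> /andP[d0 d1]; have H := floor_bounds z; have /andP[h1 h2] := H.
rewrite (betaE H) /frac; have [t|t] := leP (Num.floor z)%:~R (z - d).
  rewrite (@betaE (z - d) (Num.floor z)); last by apply/andP; split; lra.
  by rewrite /bern; nra.
rewrite (@betaE (z - d) (Num.floor z - 1)) intrD rmorphN /=; last by apply/andP; split; lra.
by rewrite /bern; nra.
Qed.

(** The part of [beta] that is antiperiodic under a shift by 1/2; by duplication the other part is
    [beta (2 * z) / 4]. *)
Definition gamma z : R := (beta z - beta (z + 1 / 2)) / 2.

Lemma beta_gamma z : beta z = gamma z + beta (2 * z) / 4.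
Proof.
have -> : beta (2 * z) / 4 = (beta (2 * z) / 2) / 2 by field.
by rewrite -beta_duplication /gamma; field.
Qed.

Lemma gamma_antiperiodic z : gamma (z + 1 / 2) = - gamma z.
Proof.
rewrite /gamma; have -> : z + 1 / 2 + 1 / 2 = z + 1 by field.
by rewrite betaD1; ring.
Qed.

Lemma gamma_bounded z : `|gamma z| <= 1.
Proof.
have := beta_bounded z; have := beta_bounded (z + 1 / 2).
by rewrite /gamma !ler_norml => /andP[? ?] /andP[? ?]; apply/andP; split; lra.
Qed.

Lemma gamma_lipschitz z z' : `|gamma z - gamma z'| <= `|z - z'|.
Proof.
have H1 := beta_lipschitz z z'; have H2 := beta_lipschitz (z + 1 / 2) (z' + 1 / 2).
rewrite (_ : z + 1 / 2 - (z' + 1 / 2) = z - z') in H2; last by ring.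
move: H1 H2; rewrite /gamma !ler_norml.
by move=> /andP[? ?] /andP[? ?]; apply/andP; split; lra.
Qed.

(* [beta] is the second Bernoulli function: its difference quotients bracket [frac]. *)
Lemma average_frac (z : nat -> R) :
  (forall s, average (fun j => beta (z j + s)) @ \oo --> (0 : R)) ->
  average (fun j => frac (z j)) @ \oo --> (1 / 2 : R).
Proof.
(* Divided by [2 * d], the bracketing error [d ^+ 2] costs [d / 2] and two averages of size
   [d ^+ 2 / 4] cost [d / 4]; the total is below [d <= e]. *)
move=> H; apply/cvgrPdist_le => e e0; pose d := Num.min e 1.
have d0 : 0 < d by rewrite /d lt_min e0 ltr01.
have d1 : d <= 1 by rewrite /d ge_min lexx orbT.
have de : d <= e by rewrite /d ge_min lexx.
have dd : 0 < d <= 1 by apply/andP.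
have d2 : 0 < d ^+ 2 / 4 by rewrite divr_gt0 ?exprn_gt0.
near=> N.
have N0 : (0 < N)%N by near: N; exists 1%N.
have a0 : `|0 - average (fun j => beta (z j + 0)) N| <= d ^+ 2 / 4.
  by near: N; move/cvgrPdist_le: (H 0); exact.
have ap : `|0 - average (fun j => beta (z j + d)) N| <= d ^+ 2 / 4.
  by near: N; move/cvgrPdist_le: (H d); exact.
have am : `|0 - average (fun j => beta (z j - d)) N| <= d ^+ 2 / 4.
  by near: N; move/cvgrPdist_le: (H (- d)); exact.
have fw : average (fun j => beta (z j + d) - beta (z j + 0)) N <=
    average (fun j => 2 * d * frac (z j) + (d ^+ 2 - d)) N.
  by apply: le_average => j; have := beta_forward (z j) dd; rewrite addr0 addrA addrAC.
have bw : average (fun j => 2 * d * frac (z j) + (- d ^+ 2 - d)) N <=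
    average (fun j => beta (z j + 0) - beta (z j - d)) N.
  by apply: le_average => j; have := beta_backward (z j) dd; rewrite addr0 addrA addrAC.
rewrite averageB [X in _ <= X]averageD averageZ average_cst // in fw.
rewrite averageB [X in X <= _]averageD averageZ average_cst // in bw.
move: a0 ap am fw bw; rewrite !sub0r !normrN !ler_norml.
move=> /andP[a1 a2] /andP[a3 a4] /andP[a5 a6] fw bw.
set F := average (fun j => frac (z j)) N in fw bw *.
have dF1 : d * (1 / 2 - F) <= d * d by nra.
have dF2 : d * (F - 1 / 2) <= d * d by nra.
rewrite !ler_pM2l // in dF1 dF2.
by apply/andP; split; lra.
Unshelve. all: end_near. Qed.

(** The null set must not depend on [s]: rational shifts are treated first, as a countable family,
    and real shifts follow from the Lipschitz bound. *)
Lemma beta_average : {ae (@lebesgue_measure R), forall x, good x -> forall s,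
  average (fun j => beta (cf_theta R (cf_word x j.+1) + s)) @ \oo --> (0 : R)}.
Proof.
(* Enumerates the rationals by naturals; codes of no rational are sent to 0. *)
pose r n : R := ratr (odflt 0 (unpickle n)).
have rP (q : rat) : r (pickle q) = ratr q by rewrite /r pickleK.
have H l n : {ae (@lebesgue_measure R), forall x, good x ->
    average (fun j => gamma (2 ^+ l * (cf_theta R (cf_word x j) + r n))) @ \oo --> (0 : R)}.
  have p0 : 0 < (2 : R) ^+ l by rewrite exprn_gt0.
  (* A shift of the phase by [2^-(l+1)] moves the argument of [gamma] by 1/2. *)
  apply: (@antiperiodic_average _ (fun th => gamma (2 ^+ l * (th + r n)))
    (2 ^- l.+1) (2 ^+ l) 1).
  - rewrite invr_gt0 exprn_gt0 //= invf_le1 ?exprn_gt0 //.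
    by rewrite exprn_ege1 // ler1n.
  - exact: ltW.
  - by move=> th; exact: gamma_bounded.
  - move=> th th'; apply: le_trans (gamma_lipschitz _ _) _.
    rewrite -mulrBr (_ : th + r n - (th' + r n) = th - th'); last by ring.
    by rewrite normrM gtr0_norm.
  move=> th; rewrite -gamma_antiperiodic; congr gamma.
  by rewrite exprS; field; rewrite gt_eqF.
apply: ae_impl (ae_foralln (fun l => ae_foralln (H l))) => x {}H xg.
have rat_shift n : average (fun j => beta (cf_theta R (cf_word x j) + r n)) @ \oo --> (0 : R).
  (* After [l] duplications the remainder is [4^-l] times a bounded average. *)
  pose a l := average (fun j => beta (2 ^+ l * (cf_theta R (cf_word x j) + r n))).
  have a0 l : (fun N => a 0%N N - 4 ^- l * a l N) @ \oo --> (0 : R).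
    elim: l => [|l IHl].
      by apply: (eq_cvg_seq (v := fun=> 0)) => [N|];
        [rewrite expr0 invr1 mul1r subrr|exact: cvg_cst].
    pose g N := average (fun j => gamma (2 ^+ l * (cf_theta R (cf_word x j) + r n))) N.
    have E N : a 0%N N - 4 ^- l.+1 * a l.+1 N = (a 0%N N - 4 ^- l * a l N) + 4 ^- l * g N.
      have -> : a l N = g N + 4^-1 * a l.+1 N; last by rewrite exprS invfM; ring.
      rewrite -averageZ -averageD; congr average; apply/funext => j.
      by rewrite beta_gamma exprS -mulrA mulrC [_ * 4^-1]mulrC [4^-1 * _]mulrC.
    apply: eq_cvg_seq E _.
    rewrite -[X in _ --> X](addr0 0); apply: cvgD => //.
    by rewrite -[X in _ --> X](mulr0 (4 ^- l)); apply: cvgMr; exact: H.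
  have -> : (fun j => beta (cf_theta R (cf_word x j) + r n)) =
      (fun j => beta (2 ^+ 0 * (cf_theta R (cf_word x j) + r n))).
    by apply/funext => j; rewrite expr0 mul1r.
  apply: cvg0_approx => e e0.
  have : (fun k => (4^-1 : R) ^+ k) @ \oo --> (0 : R).
    by apply: cvg_expr; rewrite ger0_norm; lra.
  move=> /cvgrPdist_le/(_ _ e0)[l _ /(_ l (leqnn l))].
  rewrite /= sub0r normrN ger0_norm ?exprn_ge0 ?invr_ge0 // exprVn => le.
  exists (fun N => 4 ^- l * a l N); first exact: (a0 l).
  move=> N; rewrite normrM (ger0_norm (x := 4 ^- l)) ?invr_ge0 ?exprn_ge0 //.
  rewrite -[leRHS]mulr1; apply: ler_pM => //.
  apply: average_bounded => // j; apply: le_trans (beta_bounded _) _; lra.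
move=> s.
have shift : average (fun j => beta (cf_theta R (cf_word x j) + s)) @ \oo --> (0 : R).
  apply: cvg0_approx => e e0.
  have /rat_in_itvoo[q] : s < s + e by rewrite ltrDl.
  rewrite in_itv /= -rP => /andP[q1 q2].
  exists (average (fun j => beta (cf_theta R (cf_word x j) + s) -
       beta (cf_theta R (cf_word x j) + r (pickle q)))).
    apply: (eq_cvg_seq (v := average (fun j => beta (cf_theta R (cf_word x j) + r (pickle q))))).
      by move=> N; rewrite averageB opprB addrC subrK.
    exact: rat_shift.
  move=> N; apply: average_bounded (ltW e0) _ => j.
  apply: le_trans (beta_lipschitz _ _) _; rewrite opprD addrACA subrr add0r.
  by rewrite ler_norml; apply/andP; split; lra.
(* The time index is moved by one, since the Benford count starts at [q_1]. *)
pose b j := beta (cf_theta R (cf_word x j) + s).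
have E N : average (fun j => b j.+1) N = (average (fun j => b j.+1) N - average b N) +
    average b N by rewrite subrK.
apply: eq_cvg_seq E _.
rewrite -[X in _ --> X](addr0 0); apply: cvgD shift.
by apply: (@cvg_average_shift _ _ (1 / 6)) => j; exact: beta_bounded.
Qed.

(** [frac (s - z)] is [s - frac z] when [frac z <= s], and larger by 1 otherwise. *)
Lemma frac_le_indicator s z : 0 <= s < 1 ->
  ((frac z <= s)%R%:R : R) = 1 + s - frac z - frac (s - z).
Proof.
move=> /andP[s0 s1]; have /andP[f0 f1] := frac_itv z.
have [fs|sf] := leP (frac z) s; move: f0 f1 fs || move: f0 f1 sf; rewrite /frac => f0 f1 fs.
  rewrite -/(frac (s - z)) (@fracE _ (- Num.floor z)) rmorphN /=; first by ring.
  by apply/andP; split; lra.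
rewrite -/(frac (s - z)) (@fracE _ (- Num.floor z - 1)) intrD !rmorphN /=; first by ring.
by apply/andP; split; lra.
Qed.

(** Since [beta] is even, the hypothesis on [z] also gives the averages for [s - z]; both fractional
    parts then average to 1/2. *)
Lemma average_frac_le (z : nat -> R) s : 0 <= s < 1 ->
  (forall s, average (fun j => beta (z j + s)) @ \oo --> (0 : R)) ->
  average (fun j => (frac (z j) <= s)%R%:R) @ \oo --> s.
Proof.
move=> ss H; have H' : average (fun j => frac (s - z j)) @ \oo --> (1 / 2 : R).
  apply: average_frac => t.
  have -> : (fun j => beta (s - z j + t)) = (fun j => beta (z j + (- s - t))).
    by apply/funext => j; rewrite -betaN; congr beta; ring.
  exact: H.
have E N : average (fun j => (frac (z j) <= s)%R%:R) N = average (fun=> 1 + s) N -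
    average (fun j => frac (z j)) N - average (fun j => frac (s - z j)) N.
  by rewrite -!averageB; congr average; apply/funext => j; rewrite frac_le_indicator.
apply: eq_cvg_seq E _.
rewrite -[X in _ --> X](_ : 1 + s - 1 / 2 - 1 / 2 = s); last by field.
by apply: cvgB => //; apply: cvgB; [exact: cvg_average_cst|exact: average_frac].
Qed.

(** * Significands and the Benford property *)

Lemma significand_le (y t : R) : 0 < y -> 0 < t ->
  (significand y <= t) = (frac (log10 y) <= log10 t).
Proof.
move=> y0 t0; have l0 := ln10_gt0 R.
have p0 : 0 < 10 `^ (Num.floor (log10 y))%:~R :> R by rewrite powR_gt0.
rewrite /significand gtr0_norm // -ler_ln ?posrE ?divr_gt0 //.
rewrite ln_div ?posrE // ln_powR /frac [X in _ = (_ <= X)]/log10 ler_pdivlMr // mulrBl.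
suff -> : log10 y * ln 10 = ln y by [].
by rewrite /log10 divfK // gt_eqF.
Qed.

End BernoulliFunction.

Theorem theorem1p1 (R : realType) :
  {ae (@lebesgue_measure R), forall x : R,
    0 < x < 1 -> irrational x -> benford (fun n => (cf_q x n)%:~R : R)}.
Proof.
apply: ae_impl (@beta_average R) => x H x01 xi; have xg : good x by [].
have q0 n : 0 < (cf_q x n)%:~R :> R.
  by rewrite cf_qE // ltr0z ltz_nat cf_den_gt0 ?cf_word_pos.
split=> [n _|t /andP[t1 t10]]; first by rewrite gt_eqF.
have t0 : 0 < t by lra.
have ss : 0 <= log10 t < 1.
  rewrite /log10 divr_ge0 ?ln_ge0 // ?(ltW (ln10_gt0 R)) //=; last by rewrite ler1n.
  by rewrite ltr_pdivrMr ?ln10_gt0 // mul1r ltr_ln ?posrE.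
apply: cvg_trans (average_frac_le ss (H xg)); apply: near_eq_cvg; apply: nearW => N /=.
rewrite /average; congr (_ / _); elim: N => [|N IHN]; first by rewrite big_nil.
have iotaS : iota 1 N.+1 = iota 1 N ++ [:: N.+1].
  by have := iotaD 1 N 1; rewrite addn1 add1n.
rewrite iotaS count_cat natrD big_nat_recr // IHN /= addn0.
by rewrite significand_le ?q0 // /cf_theta cf_qE.
Qed.
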